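(* Let $K$ be any field, let $d\ge 2$ be an even integer, $m=d-1=2p+1$, and $D=\binom{m}{p}$. Let $\phi_L:K^m\otimes K^{m+1}\otimes K^{m+1}\to\operatorname{Mat}_{(m+1)D,(m+1)D}$ be the linear map $\sum_is_i\otimes X_i\mapsto\sum_iL(s_i)\otimes X_i$, where $L:K^m\to\operatorname{Hom}(\bigwedge^pK^m,\bigwedge^{p+1}K^m)$ is given by $L(v)(w)=v\wedge w$; thus $\det(\phi_L)$ is a polynomial on $K^{d-1}\otimes K^d\otimes K^d$. Let $\pi:K^d\to K^{d-1}$ be any projection (surjective linear map), let $\psi=\pi\otimes\operatorname{id}\otimes\operatorname{id}:K^d\otimes K^d\otimes K^d\to K^{d-1}\otimes K^d\otimes K^d$, and let $f=\psi^*(\det\phi_L)$ be the pullback of $\det(\phi_L)$ under $\psi$, i.e. $f(T)=\det(\phi_L(\psi(T)))$. Then $f$ is a non-trivial (i.e. nonzero) polynomial on $K^d\otimes K^d\otimes K^d$ that vanishes on all tensors of border rank $\le 2d-3$.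
   Context: $\operatorname{Mat}_{r,s}$ is the space of $r\times s$ matrices over $K$. In the definition of $\phi_L$, $s_i\in K^m$ and $X_i\in K^{m+1}\otimes K^{m+1}$; the space $K^{m+1}\otimes K^{m+1}$ is identified with $\operatorname{Mat}_{m+1,m+1}$ via $e_j\otimes e_k\leftrightarrow E_{j,k}$; $\operatorname{Hom}(\bigwedge^pK^m,\bigwedge^{p+1}K^m)$ is identified with $\operatorname{Mat}_{D,D}$ via chosen bases; and $\operatorname{Mat}_{D,D}\otimes\operatorname{Mat}_{m+1,m+1}$ is identified with $\operatorname{Mat}_{(m+1)D,(m+1)D}$ by the Kronecker product. The tensor rank of a tensor is the smallest $n$ such that it is a sum of $n$ pure tensors; $Z_n$ is the set of tensors of tensor rank $\le n$, $\overline Z_n$ its Zariski closure; the border rank of $T$ is the smallest $n$ with $T\in\overline Z_n$. *)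

(* Defs.v *)
From HB Require Import structures.
From mathcomp Require Import all_boot all_order all_algebra.
From mathcomp.multinomials Require Export mpoly.
From mathcomp.real_closed Require Export mxtens.

Set Implicit Arguments.
Unset Strict Implicit.
Unset Printing Implicit Defensive.

Import GRing.Theory.
Local Open Scope ring_scope.

(* K^o is K as a module over itself, which makes K^I a vectType *)
Notation coords K I := {ffun I -> K^o} (only parsing).

Definition delta (K : fieldType) (I : finType) (t : I) : coords K I :=
  [ffun u => (u == t)%:R].

Lemma coords_sum_delta (K : fieldType) (I : finType) (x : coords K I) :
  x = \sum_t x t *: delta K t.
Proof.
apply/ffunP => u; rewrite sum_ffunE (bigD1 u) //= big1 ?addr0.
  by rewrite !ffunE eqxx /GRing.scale /= mulr1.
by move=> t ntu; rewrite !ffunE eq_sym (negbTE ntu) scaler0.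
Qed.

Section Polynomials.
Variable K : fieldType.

(* Polynomials are formal (K may be finite): a polynomial on K^I has one
   variable for each t : I, namely 'X_(enum_rank t), the t-th coordinate. *)
Definition polyOn (I : finType) := {mpoly K[#|I|]}.

Definition peval (I : finType) (P : polyOn I) (x : coords K I) : K :=
  P.@[fun i => x (enum_val i)].

Definition linform (I : finType) (g : coords K I -> K) : polyOn I :=
  \sum_t g (delta K t) *: 'X_(enum_rank t).

Lemma peval_linform (I : finType) (g : coords K I -> K^o) (x : coords K I) :
  linear g -> peval (linform g) x = g x.
Proof.
move=> lg.
pose G := GRing.isLinear.Build K (coords K I) K^o _ g lg.
pose h : {linear coords K I -> K^o} := HB.pack g G.
rewrite [in RHS](coords_sum_delta x) -[g]/(h : _ -> _) linear_sum /=.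
rewrite /peval /linform rmorph_sum /=; apply: eq_bigr => t _.
by rewrite mevalZ mevalXU enum_rankK mulrC; exact: esym (linearZZ h _ _).
Qed.

(* h^* P, the composite of P with the linear map h *)
Definition pullback (I J : finType) (h : coords K I -> coords K J)
    (P : polyOn J) : polyOn I :=
  P \mPo [tuple linform (fun x => h x (enum_val j)) | j < #|J|].

(* the determinant of a matrix-valued linear map, as a polynomial *)
Definition detpoly (I : finType) (n : nat) (F : coords K I -> 'M[K]_n) :
    polyOn I :=
  \det (\matrix_(i, j) linform (fun x => F x i j)).

Lemma peval_pullback (I J : finType) (h : coords K I -> coords K J)
    (P : polyOn J) (x : coords K I) :
  linear h -> peval (pullback h P) x = peval P (h x).
Proof.
move=> lh; rewrite /peval /pullback comp_mpoly_meval.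
apply: meval_eq => j; rewrite tnth_mktuple.
apply: (peval_linform (g := fun x => h x (enum_val j))) => a u v.
by rewrite lh !ffunE.
Qed.

Lemma peval_detpoly (I : finType) (n : nat) (F : coords K I -> 'M[K]_n)
    (x : coords K I) :
  linear F -> peval (detpoly F) x = \det (F x).
Proof.
move=> lF; rewrite /peval /detpoly -det_map_mx; congr (\det _).
apply/matrixP => i j; rewrite !mxE.
apply: (peval_linform (g := fun x => F x i j)) => a u v.
by rewrite lF !mxE.
Qed.

Definition zariski_closure (I : finType) (Z : coords K I -> Prop)
    (x : coords K I) : Prop :=
  forall P : polyOn I, (forall z, Z z -> peval P z = 0) -> peval P x = 0.

End Polynomials.

(* K^a (x) K^b (x) K^c, in the basis e_i (x) e_j (x) e_k *)
Notation tensor K a b c := (coords K ('I_a * 'I_b * 'I_c)%type) (only parsing).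

Section Rank.
Variables (K : fieldType) (a b c : nat).

Definition pure (u : 'rV[K]_a) (v : 'rV[K]_b) (w : 'rV[K]_c) :
    tensor K a b c :=
  [ffun t => u 0 t.1.1 * v 0 t.1.2 * w 0 t.2].

Definition sum_of_pure (T : tensor K a b c) (n : nat) : Prop :=
  exists (u : 'I_n -> 'rV[K]_a) (v : 'I_n -> 'rV[K]_b) (w : 'I_n -> 'rV[K]_c),
    T = \sum_(i < n) pure (u i) (v i) (w i).

Definition smallest (P : nat -> Prop) (n : nat) : Prop :=
  P n /\ forall k, P k -> (n <= k)%N.

Definition tensor_rank (T : tensor K a b c) : nat -> Prop :=
  smallest (sum_of_pure T).

Definition Zrank (n : nat) (T : tensor K a b c) : Prop :=
  exists r, tensor_rank T r /\ (r <= n)%N.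

Definition border_rank (T : tensor K a b c) : nat -> Prop :=
  smallest (fun n => zariski_closure (Zrank n) T).

End Rank.

Section Exterior.
Variables (K : fieldType) (m : nat).

(* The exterior algebra of K^m: delta A stands for e_i1 /\ ... /\ e_ik, where
   i1 < ... < ik are the elements of A. *)
Notation ext := (coords K {set 'I_m}).

(* the number of adjacent transpositions needed to sort e_A /\ e_B *)
Definition ninv (A B : {set 'I_m}) : nat :=
  #|[set ij : 'I_m * 'I_m |
      [&& ij.1 \in A, ij.2 \in B & (ij.2 < ij.1)%N]]|.

Definition wedge (x y : ext) : ext :=
  \sum_(A : {set 'I_m}) \sum_(B : {set 'I_m} | [disjoint A & B])
    ((-1) ^+ ninv A B * x A * y B) *: delta K (A :|: B).

Definition ext_vec (v : 'rV[K]_m) : ext :=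
  \sum_i v 0 i *: delta K [set i].

Lemma wedge_delta (A B : {set 'I_m}) :
  wedge (delta K A) (delta K B) =
  if [disjoint A & B] then (-1) ^+ ninv A B *: delta K (A :|: B) else 0.
Proof.
rewrite /wedge (bigD1 A) //= [X in _ + X]big1 ?addr0.
  rewrite big_mkcond (bigD1 B) //= [X in _ + X]big1 ?addr0.
    by rewrite !ffunE !eqxx /= !mulr1.
  move=> C nCB; case: ifP => // _.
  by rewrite !ffunE (negbTE nCB) mulr0 scale0r.
move=> C nCA; rewrite big1 // => E _.
by rewrite !ffunE (negbTE nCA) mulr0 mul0r scale0r.
Qed.

Lemma wedge_linear_r (x : ext) : linear (wedge x).
Proof.
move=> a u v; rewrite /wedge scaler_sumr -big_split; apply: eq_bigr => A _ /=.
rewrite scaler_sumr -big_split; apply: eq_bigr => B _ /=.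
rewrite scalerA -scalerDl; congr (_ *: _).
by rewrite !ffunE mulrDr [a *: _]/GRing.scale /= mulrCA.
Qed.

Lemma wedge_linear_l (y : ext) : linear (wedge^~ y).
Proof.
move=> a u v; rewrite /wedge scaler_sumr -big_split; apply: eq_bigr => A _ /=.
rewrite scaler_sumr -big_split; apply: eq_bigr => B _ /=.
rewrite scalerA -scalerDl; congr (_ *: _).
by rewrite !ffunE mulrDr mulrDl [a *: _]/GRing.scale /= mulrCA !mulrA.
Qed.

Lemma ext_vec_linear : linear ext_vec.
Proof.
move=> a u v; rewrite /ext_vec scaler_sumr -big_split; apply: eq_bigr => i _ /=.
by rewrite !mxE scalerDl scalerA.
Qed.

Definition extpow (k : nat) : {vspace ext} :=
  <<[seq delta K A | A in [set A : {set 'I_m} | #|A| == k]]>>%VS.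

(* the matrix of a linear map (coordinates of the images in columns) *)
Definition mx_of (r s : nat) (b : r.-tuple ext) (b' : s.-tuple ext)
    (g : ext -> ext) : 'M[K]_(s, r) :=
  \matrix_(i, j) coord b' i (g (tnth b j)).

Definition L (v : 'rV[K]_m) (w : ext) : ext := wedge (ext_vec v) w.

Lemma dim_extpow (k : nat) : \dim (extpow k) = 'C(m, k).
Proof.
rewrite /extpow -[m in RHS]card_ord -card_draws.
set P := [set _ | _].
have fr : free (map_tuple (@delta K _) (enum_tuple P)).
  apply/freeP => c sum0 i; pose t := tnth (enum_tuple P).
  have /ffunP/(_ (t i)) := sum0.
  have nth_t (j : 'I_#|P|) : [seq delta K A | A in P]`_j = delta K (t j).
    by rewrite (nth_map set0) -?cardE // -tnth_nth.
  rewrite sum_ffunE (bigD1 i) //= nth_t big1 ?addr0.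
    by rewrite !ffunE eqxx /GRing.scale /= mulr1.
  move=> j nji; rewrite nth_t !ffunE; case: eqP => [/tuple_uniqP eq_t|].
    by rewrite eq_t ?eqxx ?enum_uniq // in nji.
  by rewrite scaler0.
by have := fr; rewrite /free => /eqP ->; rewrite size_map -cardE.
Qed.

End Exterior.

Notation ext K m := (coords K {set 'I_m}) (only parsing).

Section Phi.
Variables (K : fieldType) (m r s n n' : nat).
Variables (b : r.-tuple (ext K m)) (b' : s.-tuple (ext K m)).

Definition Lmx (v : 'rV[K]_m) : 'M[K]_(s, r) := mx_of b b' (L v).

(* T = \sum_i e_i (x) X_i, where X_i is the i-th slice of T; see phi_tens for
   the value at an arbitrary s (x) X *)
Definition phi (T : tensor K m n n') : 'M[K]_(s * n, r * n') :=
  \sum_i Lmx (delta_mx 0 i) *t (\matrix_(j, k) T (i, j, k)).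

Lemma Lmx_linear : linear Lmx.
Proof.
move=> a u v; apply/matrixP => i j; rewrite !mxE /L.
by rewrite ext_vec_linear wedge_linear_l linearP.
Qed.

Lemma phi_linear : linear phi.
Proof.
move=> a u v; rewrite /phi scaler_sumr -big_split; apply: eq_bigr => i _ /=.
apply/matrixP => j k; rewrite !mxE !ffunE.
by rewrite mulrDr [a *: _]/GRing.scale /= mulrCA.
Qed.

Lemma phi_tens (v : 'rV[K]_m) (X : 'M[K]_(n, n')) :
  phi [ffun t => v 0 t.1.1 * X t.1.2 t.2] = Lmx v *t X.
Proof.
pose h : {linear 'rV[K]_m -> 'M[K]_(s, r)} :=
  HB.pack Lmx (GRing.isLinear.Build K _ _ _ _ Lmx_linear).
have -> : Lmx v = \sum_i v 0 i *: Lmx (delta_mx 0 i).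
  rewrite [in LHS](row_sum_delta v) -[Lmx]/(h : _ -> _) linear_sum /=.
  by apply: eq_bigr => i _; exact: (linearZZ h).
apply/matrixP => j k; rewrite /phi !mxE !summxE mulr_suml.
by apply: eq_bigr => i _; rewrite !mxE !ffunE /= mulrCA mulrA.
Qed.

End Phi.

(* pi (x) id (x) id *)
Definition psi (K : fieldType) (a a' b c : nat)
    (pi : {linear 'rV[K]_a -> 'rV[K]_a'}) (T : tensor K a b c) :
    tensor K a' b c :=
  [ffun t => pi (\row_i T (i, t.1.2, t.2)) 0 t.1.1].

Lemma psi_linear (K : fieldType) (a a' b c : nat)
    (pi : {linear 'rV[K]_a -> 'rV[K]_a'}) :
  linear (@psi K a a' b c pi).
Proof.
move=> x u v; apply/ffunP => t; rewrite !ffunE.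
set U := \row_i u _; set V := \row_i v _.
have -> : \row_i (x *: u + v) (i, t.1.2, t.2) = x *: U + V.
  by apply/rowP => i; rewrite !mxE !ffunE.
by rewrite linearP !mxE.
Qed.

Lemma psi_pure (K : fieldType) (a a' b c : nat)
    (pi : {linear 'rV[K]_a -> 'rV[K]_a'})
    (u : 'rV[K]_a) (v : 'rV[K]_b) (w : 'rV[K]_c) :
  psi pi (pure u v w) = pure (pi u) v w.
Proof.
apply/ffunP => t; rewrite !ffunE.
have -> : \row_i pure u v w (i, t.1.2, t.2) = (v 0 t.1.2 * w 0 t.2) *: u.
  by apply/rowP => i; rewrite !mxE !ffunE /= -mulrA mulrC.
by rewrite linearZ mxE mulrC mulrA.
Qed.

Lemma peval_pullback_det_phi (K : fieldType) (m r n d : nat)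
    (b b' : r.-tuple (ext K m)) (pi : {linear 'rV[K]_d -> 'rV[K]_m})
    (T : tensor K d n n) :
  peval (pullback (psi pi) (detpoly (phi b b'))) T = \det (phi b b' (psi pi T)).
Proof.
rewrite peval_pullback ?peval_detpoly //; [exact: phi_linear|exact: psi_linear].
Qed.

(* Main.v *)
From HB Require Import structures.
Require Import Defs.
From mathcomp Require Import all_boot all_order all_algebra.
From mathcomp Require Import fraction ring zify.

Set Implicit Arguments.
Unset Strict Implicit.
Unset Printing Implicit Defensive.

Import GRing.Theory.
Local Open Scope ring_scope.

(** Write m = 2p+1, so that d = 2(p+1) and D = 'C(m, p).

    Vanishing. The polynomial f is given by a determinant of size D * d, and
    f vanishes on a Zariski closure as soon as it vanishes on the sums of r
    pure tensors. On a pure tensor u (x) v (x) w the matrix is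
    L(u) (x) v^T w, whose rank is at most the rank of L(u). For u <> 0 that
    rank is at most 'C(2p, p): contraction with a functional tau such that
    tau(u) = 1 is a homotopy, so u /\ x = u /\ tau(u /\ x), and if tau is
    proportional to the i-th coordinate then tau(u /\ x) only involves the
    e_A with i not in A ([rank_Lmx]). Since D * d = 2(2p+1) 'C(2p, p)
    ([koszul_dim]) and 2d - 3 < 2(2p+1), the matrix is singular on every sum
    of 2d - 3 pure tensors.

    Nonvanishing. Because pi is onto, it is enough to find one tensor in
    K^m (x) K^d (x) K^d at which det(phi_L) is nonzero. The witness is the
    direct sum of two copies of the tensor of polynomial multiplication
    K[X]_(<= p) x K[X]_(<= p) -> K[X]_(<= 2p), i.e. of the Hankel matrix
    (e_(j+k)) with 0 <= j, k <= p. It works in every characteristic, for the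
    following reason. Identify the exterior power of order p of K[X]_(<= 2p)
    with alternating polynomials in p variables. A family (x_k) of p+1
    elements then becomes one polynomial F(t_1, ..., t_p; s) of degree at most
    p in s, and the map given by the Hankel matrix sends it to the functional

      c |-> sum_i (-1)^i c(t_i) F(t_0, .., omit t_i, .., t_p; t_i)

    on polynomials c of degree at most p. If this vanishes for all c, then the
    choice c = (X - t_1)...(X - t_p) isolates the term i = 0, so
    F(t_1, ..., t_p; t_0) = 0 for distinct t_i, and F = 0 if the field is
    infinite.

    In the proof, evaluation at (t_1, ..., t_p) takes the form of an iterated
    contraction with the functionals g |-> g(t_i) ([icontr]), and the
    formula above follows from the rule
    tau(v /\ x) = <tau, v> x - v /\ tau(x) ([contrL]). The core is
    [hankel_inj], over an infinite field; [hankel_injective] removes that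
    restriction by passing to the field K(X). *)

(** * Exterior multiplication and contraction in coordinates *)

Section ExteriorOperators.
Variables (K : fieldType) (m : nat).
Implicit Types (i j : 'I_m) (A B : {set 'I_m}) (v tau : 'rV[K]_m).
Implicit Types (x y : ext K m).

(** The sign for which e_i /\ e_A = sgn i A *: e_(i |: A) when i is not in A. *)
Definition sgn i A : K := (-1) ^+ ninv [set i] A.

Lemma sgnK i A : sgn i A * sgn i A = 1.
Proof. by rewrite -expr2 sqrr_sign. Qed.

Lemma sgn_setU1 i j A :
  j \notin A -> sgn i (j |: A) = (-1) ^+ (j < i)%N * sgn i A.
Proof.
move=> jA; rewrite -exprD; congr (_ ^+ _).
have ninvE B : ninv [set i] B = (\sum_(b in B) (b < i))%N.
  rewrite -big_mkcondr sum1_card /ninv.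
  rewrite -[RHS](card_image (f := pair i)); last by move=> b c [].
  apply: eq_card => -[a b]; rewrite !inE /=.
  apply/idP/imageP => [/and3P[/eqP-> bB lb]|[c /andP[cB lc] [-> ->]]].
    by exists b => //; apply/andP.
  by rewrite eqxx cB.
by rewrite !ninvE big_setU1.
Qed.

(** The sign rule behind e_i /\ e_j = - e_j /\ e_i: exactly one of i < j and
    j < i adds an inversion. *)
Lemma sgn_swap i j A : i != j -> i \notin A -> j \notin A ->
  sgn j (i |: A) * sgn i (j |: A) = - (sgn i A * sgn j A).
Proof.
move=> ij iA jA; rewrite !sgn_setU1 // mulrACA -exprD [sgn j A * _]mulrC.
have -> : ((i < j) + (j < i) = 1)%N.
  by case: ltngtP => // /val_inj eij; rewrite eij eqxx in ij.
by rewrite expr1 mulN1r.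
Qed.

Lemma L_linear_l x : linear ((@L K m)^~ x).
Proof. by move=> a u v; rewrite /L ext_vec_linear wedge_linear_l. Qed.

Lemma L_linear v : linear (L v).
Proof. exact: wedge_linear_r. Qed.

HB.instance Definition _ v :=
  GRing.isLinear.Build K (ext K m) (ext K m) _ (L v) (L_linear v).

Lemma LE v x A :
  L v x A = \sum_(i in A) v 0 i * sgn i (A :\ i) * x (A :\ i).
Proof.
have wE : wedge (ext_vec v) x = \sum_i v 0 i *: wedge (delta K [set i]) x.
  pose h := HB.pack_for {linear ext K m -> ext K m} ((@wedge K m)^~ x)
    (GRing.isLinear.Build K _ _ _ _ (wedge_linear_l x)).
  rewrite -[wedge _ _]/(h _) linear_sum.
  by apply: eq_bigr => i _; rewrite linearZ.
rewrite /L wE sum_ffunE [RHS]big_mkcond; apply: eq_bigr => i _ /=.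
rewrite ffunE /wedge (bigD1 [set i]) //= [X in _ + X]big1 ?addr0; last first.
  move=> B nB; rewrite big1 // => C _.
  by rewrite ffunE (negbTE nB) mulr0 mul0r scale0r.
rewrite sum_ffunE; case: ifP => iA.
  have iAi : [disjoint [set i] & A :\ i] by rewrite disjoints1 !inE eqxx.
  rewrite (bigD1 (A :\ i)) //= [X in _ + X]big1 ?addr0.
    rewrite !ffunE eqxx setD1K // eqxx mulr1 /GRing.scale /= mulr1.
    by rewrite -/(sgn _ _) mulrA.
  move=> B /andP[iB nB]; rewrite !ffunE.
  case: (A =P _) => [eA|_]; last by rewrite scaler0.
  by rewrite eA setU1K ?eqxx // -disjoints1 in nB.
rewrite big1 ?scaler0 // => B _; rewrite !ffunE; case: (A =P _) => [eA|_].
  by rewrite eA setU11 in iA.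
by rewrite scaler0.
Qed.

Lemma L0l x : L 0 x = 0.
Proof.
by apply/ffunP => A; rewrite LE ffunE big1 // => i _; rewrite mxE !mul0r.
Qed.

Definition contr tau x : ext K m :=
  [ffun A : {set 'I_m} => \sum_(i | i \notin A) tau 0 i * sgn i A * x (i |: A)].

Lemma contr_linear tau : linear (contr tau).
Proof.
move=> a x y; apply/ffunP => A; rewrite !ffunE scaler_sumr -big_split /=.
by apply: eq_bigr => i _; rewrite !ffunE mulrDr [a *: _]/GRing.scale /= mulrCA.
Qed.

HB.instance Definition _ tau :=
  GRing.isLinear.Build K (ext K m) (ext K m) _ (contr tau) (contr_linear tau).

Lemma contr_linear_l x : linear (contr^~ x).
Proof.
move=> a u v; apply/ffunP => A; rewrite !ffunE scaler_sumr -big_split /=.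
apply: eq_bigr => i _.
by rewrite !mxE !mulrDl [a *: _]/GRing.scale /= !mulrA.
Qed.

(** Contraction is an antiderivation. The diagonal terms i = j give the scalar
    product, since each i lies either in A or outside of it, and the terms with
    i <> j cancel in pairs by [sgn_swap]. *)
Lemma contrL tau v x :
  contr tau (L v x) = (\sum_i tau 0 i * v 0 i) *: x - L v (contr tau x).
Proof.
apply/eqP; rewrite eq_sym subr_eq eq_sym; apply/eqP/ffunP => A.
rewrite !ffunE LE [_ *: _]/GRing.scale /=.
have -> : \sum_(j | j \notin A) tau 0 j * sgn j A * L v x (j |: A) =
    \sum_(j | j \notin A) tau 0 j * v 0 j * x A +
    \sum_(j | j \notin A) \sum_(i in A)
      tau 0 j * sgn j A * (v 0 i * sgn i (j |: A :\ i) * x (j |: A :\ i)).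
  rewrite -big_split /=; apply: eq_bigr => j jA.
  rewrite LE big_setU1 //= mulrDr mulr_sumr setU1K //; congr (_ + _).
    by rewrite -[RHS]mul1r -(sgnK j A); ring.
  apply: eq_bigr => i iA; suff -> : (j |: A) :\ i = j |: A :\ i by [].
  have nij : i != j by apply: contraNneq jA => <-.
  apply/setP => k; rewrite !inE; case: (k =P i) => [->|]; last by rewrite andTb.
  by rewrite (negbTE nij).
have -> : \sum_(i in A) v 0 i * sgn i (A :\ i) * contr tau x (A :\ i) =
    \sum_(i in A) tau 0 i * v 0 i * x A +
    \sum_(j | j \notin A) \sum_(i in A)
      v 0 i * sgn i (A :\ i) * (tau 0 j * sgn j (A :\ i) * x (j |: A :\ i)).
  rewrite [X in _ + X]exchange_big -big_split /=; apply: eq_bigr => i iA.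
  rewrite ffunE (bigD1 i) ?setD11 //= setD1K // mulrDr mulr_sumr; congr (_ + _).
    by rewrite -[RHS]mul1r -(sgnK i (A :\ i)); ring.
  apply: eq_bigl => j; rewrite !inE.
  case: (j =P i) => [->|_]; last by rewrite andbT.
  by rewrite iA.
rewrite addrACA -[X in X + _]addrC -big_distrl/= -big_distrl /=.
rewrite -mulrDl [X in X * _](_ : _ = \sum_i tau 0 i * v 0 i); last first.
  by rewrite [RHS](bigID (mem A)).
rewrite -[RHS]addr0; congr (_ + _); rewrite -big_split big1 //= => j jA.
rewrite -big_split big1 //= => i iA.
have nij : i != j by apply: contraNneq jA => <-.
have jAi : j \notin A :\ i by rewrite !inE negb_and jA orbT.
have iAi : i \notin A :\ i by rewrite setD11.
have := sgn_swap nij iAi jAi; rewrite setD1K // => e.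
set X := x _; set a := sgn j A in e *; set b := sgn i _ in e *.
(* The terms indexed by (i, j) on both sides have opposite signs. *)
rewrite (_ : _ + _ = (a * b + sgn i (A :\ i) * sgn j (A :\ i)) *
  (tau 0 j * v 0 i * X)); last by ring.
by rewrite e addNr mul0r.
Qed.
End ExteriorOperators.

Section Homogeneous.
Variables (K : fieldType) (m : nat).
Implicit Types (i j : 'I_m) (A B : {set 'I_m}) (v tau : 'rV[K]_m).
Implicit Types (x y : ext K m).

Definition homogeneous (q : nat) x : Prop := forall A, #|A| != q -> x A = 0.

Lemma homogeneous_L q v x : homogeneous q x -> homogeneous q.+1 (L v x).
Proof.
move=> hx A; rewrite LE => nA; rewrite big1 // => i iA.
by rewrite hx ?mulr0 //; move: nA; rewrite (cardsD1 i) iA eqSS.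
Qed.

Lemma homogeneous_contr q tau x :
  homogeneous q.+1 x -> homogeneous q (contr tau x).
Proof.
move=> hx A nA; rewrite ffunE big1 // => i iA.
by rewrite hx ?mulr0 // cardsU1 iA eqSS.
Qed.

Lemma contr_homogeneous0 tau x : homogeneous 0 x -> contr tau x = 0.
Proof.
move=> hx; apply/ffunP => A; rewrite !ffunE big1 // => i iA.
by rewrite hx ?mulr0 // cardsU1 iA.
Qed.

Lemma contr_delta i A x :
  i \notin A -> contr (delta_mx 0 i) x A = sgn K i A * x (i |: A).
Proof.
move=> iA; rewrite ffunE (bigD1 i) //= !mxE !eqxx mul1r big1 ?addr0 // => j.
by case/andP => _ ji; rewrite !mxE (negbTE ji) !mul0r.
Qed.

(** In positive degree every basis element e_A has some i in A, and contraction
    with the i-th coordinate reads off the coefficients of those e_A. *)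
Lemma homogeneous_contr_eq0 q x :
  homogeneous q.+1 x -> (forall i, contr (delta_mx 0 i) x = 0) -> x = 0.
Proof.
move=> hx x0; apply/ffunP => A; rewrite [RHS]ffunE.
have [->|[i iA]] := set_0Vmem A; first by rewrite hx // cards0.
have /ffunP/(_ (A :\ i)) := x0 i.
rewrite contr_delta ?setD11 // setD1K // ffunE => /eqP.
by rewrite mulf_eq0 signr_eq0 => /eqP.
Qed.

(** By [contrL] applied twice, contractions commute with v /\ (v /\ _), so the
    coefficients can be compared by induction on the size of the index set. In
    this form the argument does not divide by 2. *)
Lemma LL_eq0 v x : L v (L v x) = 0.
Proof.
suff H n A : #|A| = n -> forall y, L v (L v y) A = 0.
  by apply/ffunP => A; rewrite (H #|A|) ?ffunE.
elim: n A => [|n IH] A; first by move/cards0_eq => -> y; rewrite LE big_set0.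
move=> cA y; have /card_gt0P[i iA] : (0 < #|A|)%N by rewrite cA.
have := contr_delta (L v (L v y)) (negbT (setD11 i A)).
rewrite setD1K // contrL contrL linearB /= linearZ /= opprB addrC subrK.
rewrite IH; last by move: cA; rewrite (cardsD1 i) iA => -[].
by move/eqP; rewrite eq_sym mulf_eq0 signr_eq0 => /eqP.
Qed.

(** Lets the subspace defined by a span be handled through supports. *)
Lemma mem_extpow q x : (x \in extpow K m q) <-> homogeneous q x.
Proof.
split=> [|hx].
  move/(@coord_span _ _ _ (in_tuple _)) => -> A nA.
  rewrite sum_ffunE big1 // => i _; rewrite ffunE /=.
  have : [seq delta K A | A in [set A : {set 'I_m} | #|A| == q]]`_i \in
     [seq delta K A | A in [set A : {set 'I_m} | #|A| == q]] by exact: mem_nth.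
  case/imageP => B; rewrite inE => /eqP cB ->; rewrite ffunE.
  by case: (A =P B) => [eA|]; [rewrite eA cB eqxx in nA | rewrite scaler0].
rewrite (coords_sum_delta x); apply: memv_suml => A _.
have [cA|nA] := eqVneq #|A| q; last by rewrite hx // scale0r mem0v.
by apply/memvZ/memv_span/imageP; exists A; rewrite ?inE ?cA.
Qed.

(** Up to the kernel of v /\ _, any x can be replaced by an element that does
    not involve e_i: this is what bounds the rank of v /\ _. *)
Lemma L_factor v i x : v 0 i != 0 ->
  L v x = L v (contr ((v 0 i)^-1 *: delta_mx 0 i) (L v x)).
Proof.
move=> vi; rewrite contrL linearB linearZ /= LL_eq0 subr0.
rewrite (bigD1 i) //= !mxE !eqxx mulr1 mulVf // big1 ?addr0 ?scale1r // => j ji.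
by rewrite !mxE (negbTE ji) mulr0 mul0r.
Qed.

Lemma contr_delta_in a i A x : i \in A -> contr (a *: delta_mx 0 i) x A = 0.
Proof.
move=> iA; rewrite ffunE big1 // => j jA.
rewrite !mxE (_ : j == i = false) ?andbF ?mulr0 ?mul0r //.
by apply: contraNF jA => /eqP ->.
Qed.

Lemma card_draws_avoiding i q :
  #|[set A : {set 'I_m} | (#|A| == q) && (i \notin A)]| = 'C(m.-1, q).
Proof.
have <- : #|[set~ i]| = m.-1 by rewrite cardsC1 card_ord.
rewrite -cards_draws; apply: eq_card => A.
by rewrite !inE -setCS setCK sub1set inE andbC.
Qed.

End Homogeneous.

(** * Rank of the Koszul flattening of a pure tensor *)

Lemma linear_suml (K : fieldType) (U V : lmodType K) (g : U -> V) (n : nat)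
  (F : 'I_n -> U) : linear g -> g (\sum_i F i) = \sum_i g (F i).
Proof.
move=> lg; pose h := HB.pack_for {linear U -> V} g
  (GRing.isLinear.Build K U V _ g lg).
exact: (linear_sum h).
Qed.

Section KoszulRank.
Variables (K : fieldType) (m r s : nat).
Variables (b : r.-tuple (ext K m)) (b' : s.-tuple (ext K m)).

(** By [L_factor], v /\ _ factors through the span of the e_A with #|A| = p and
    i not in A, where v_i <> 0; the two factors are the matrices C and E. *)
Lemma rank_Lmx p v : (forall j, homogeneous p (tnth b j)) ->
  (\rank (Lmx b b' v) <= 'C(m.-1, p))%N.
Proof.
move=> hb; have [->|/rV0Pn[i vi]] := eqVneq v 0.
  suff -> : Lmx b b' 0 = 0 by rewrite mxrank0.
  by apply/matrixP => k l; rewrite !mxE L0l linear0.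
pose W := [set A : {set 'I_m} | (#|A| == p) && (i \notin A)].
pose c x := contr ((v 0 i)^-1 *: delta_mx 0 i) (L v x).
have Lc x : homogeneous p x ->
    L v x = \sum_(k < #|W|) c x (enum_val k) *: L v (delta K (enum_val k)).
  move=> hx; rewrite {1}(L_factor x vi) -/(c x).
  rewrite [in LHS](coords_sum_delta (c x)).
  rewrite linear_sum /= (bigID (mem W)) /= [X in _ + X]big1 ?addr0 => [|A].
    rewrite [LHS]big_enum_val; apply: eq_bigr => k _; exact: linearZ.
  rewrite inE negb_and negbK => nA.
  suff -> : c x A = 0 by rewrite scale0r linear0.
  case/orP: nA => nA; last exact: contr_delta_in.
  exact: homogeneous_contr (homogeneous_L _ hx) _ nA.
pose C := \matrix_(k < s, l < #|W|) coord b' k (L v (delta K (enum_val l))).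
pose E := \matrix_(l < #|W|, j < r) (c (tnth b j) (enum_val l) : K).
rewrite (_ : Lmx b b' v = C *m E).
  by rewrite -(card_draws_avoiding i p); exact: mulmx_max_rank.
apply/matrixP => k j; rewrite !mxE Lc // linear_sum; apply: eq_bigr => l _.
by rewrite linearZ !mxE mulrC.
Qed.

(** The value at u (x) v (x) w is L(u) (x) v^T w, and a Kronecker product with a
    rank one matrix does not increase the rank. *)
Lemma rank_phi_pure (n n' p : nat) (u : 'rV[K]_m) (v : 'rV_n) (w : 'rV_n') :
  (forall j, homogeneous p (tnth b j)) ->
  (\rank (phi b b' (pure u v w)) <= 'C(m.-1, p))%N.
Proof.
move=> hb.
have -> : phi b b' (pure u v w) = Lmx b b' u *t (v^T *m w).
  rewrite -phi_tens; congr phi; apply/ffunP => t.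
  by rewrite !ffunE !mxE big_ord1 !mxE mulrA.
rewrite -[Lmx b b' u]mulmx_base -tensmx_mul.
apply: leq_trans (mulmx_max_rank _ _) _; rewrite muln1; exact: rank_Lmx.
Qed.

End KoszulRank.

(** The left-hand side is the size of the flattening; its quotient by 'C(2p, p)
    is the border rank bound given by the flattening, 2(2p+1) = 2d - 2. *)
Lemma koszul_dim (p : nat) :
  ((2 * p.+1) * 'C(2 * p + 1, p) = (2 * (2 * p + 1)) * 'C(2 * p, p))%N.
Proof.
rewrite -!mulnA; congr (2 * _)%N.
rewrite -[in 'C(2 * p + 1, p)]bin_sub ?addn1 ?leqW ?leq_pmull //.
rewrite subSn ?leq_pmull // mul2n -{2}addnn addnK -mul_bin_diag //.
Qed.

(** * Injectivity of the Hankel matrix by polynomial evaluation *)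

Section Hankel.
Variables (F : fieldType) (m : nat).
Hypothesis F_infinite : forall g : {poly F}, g != 0 -> exists t, ~~ root g t.
Implicit Types (x y : ext F m) (g : {poly F}) (ts : seq F).

(** Vectors of F^m are seen as polynomials of degree less than m; the
    functionals [evalv t] are then the evaluations at t. *)
Definition coefv g : 'rV[F]_m := \row_i g`_i.

Definition evalv (t : F) : 'rV[F]_m := \row_i t ^+ i.

(** On the exterior power of order [size ts], this is the value of the
    alternating polynomial attached to x at the points ts, up to sign. *)
Definition icontr ts x : ext F m := foldl (fun y t => contr (evalv t) y) x ts.

Lemma icontr_linear ts : linear (icontr ts).
Proof.
by elim: ts => [|t ts IH] a x y //=; rewrite linearP IH.
Qed.

HB.instance Definition _ ts :=
  GRing.isLinear.Build F (ext F m) (ext F m) _ (icontr ts) (icontr_linear ts).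

Lemma icontr_homogeneous_eq0 q ts x :
  homogeneous q x -> (q < size ts)%N -> icontr ts x = 0.
Proof.
elim: ts q x => [|t ts IH] [|q] x hx //= lq.
  by rewrite contr_homogeneous0 // linear0.
by apply: IH lq; exact: homogeneous_contr.
Qed.

Lemma contr_evalv t g x : (size g <= m)%N ->
  contr (evalv t) (L (coefv g) x) =
    g.[t] *: x - L (coefv g) (contr (evalv t) x).
Proof.
move=> sg; rewrite contrL (horner_coef_wide _ sg); congr (_ *: _ - _).
by apply: eq_bigr => i _; rewrite !mxE mulrC.
Qed.

(** A polynomial that vanishes at t anticommutes with the contraction at t, as
    the scalar term of [contrL] is its value at t. *)
Lemma icontr_roots ts g x : (size g <= m)%N -> all (root g) ts ->
  icontr ts (L (coefv g) x) = (-1) ^+ size ts *: L (coefv g) (icontr ts x).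
Proof.
move=> sg; elim: ts x => [|t ts IH] x /=; first by rewrite scale1r.
case/andP => /rootP gt /IH {}IH; rewrite contr_evalv // gt scale0r sub0r.
by rewrite linearN /= IH exprS mulN1r scaleNr.
Qed.

Lemma avoid_root g ts : g != 0 -> exists2 t, t \notin ts & ~~ root g t.
Proof.
move=> g0; have [|t] := F_infinite (g := g * \prod_(s <- ts) ('X - s%:P)).
  by rewrite mulf_neq0 // monic_neq0 // monic_prod_XsubC.
by rewrite rootM negb_or root_prod_XsubC => /andP[gt tts]; exists t.
Qed.

(** An alternating polynomial that vanishes at all tuples of distinct points
    is zero. The excluded set S makes the induction go through: fixing a first
    point t, the remaining points must avoid t. For the step, the contraction at
    t depends polynomially on t, with the contractions along the coordinates as
    its coefficients. *)
Lemma icontr_separates q (S : seq F) x : homogeneous q x ->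
  (forall ts, uniq ts -> size ts = q -> all [predC S] ts -> icontr ts x = 0) ->
  x = 0.
Proof.
elim: q S x => [|q IH] S x hx x0; first exact: (x0 [::]).
have ct t : t \notin S -> contr (evalv t) x = 0.
  move=> tS; apply: (IH (t :: S)); first exact: homogeneous_contr.
  move=> ts uts sts tsS; apply: (x0 (t :: ts)) => /=.
  - rewrite uts andbT; apply/negP => tts.
    by have /allP/(_ _ tts) := tsS; rewrite /= inE eqxx.
  - by rewrite sts.
  - rewrite tS; apply: sub_all tsS => s /=.
    by rewrite inE negb_or => /andP[].
apply: (homogeneous_contr_eq0 hx) => i; apply/ffunP => A; rewrite [RHS]ffunE.
pose c (j : nat) : F :=
  if insub j is Some j' then contr (delta_mx 0 j') x A else 0.
pose g := \poly_(j < m) c j.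
have gE t : g.[t] = contr (evalv t) x A.
  rewrite horner_poly.
  have -> : evalv t = \sum_(j < m) t ^+ j *: delta_mx 0 j.
    by rewrite [LHS]row_sum_delta; apply: eq_bigr => j _; rewrite mxE.
  pose h := HB.pack_for {linear 'rV[F]_m -> ext F m} ((@contr F m)^~ x)
    (GRing.isLinear.Build F _ _ _ _ (contr_linear_l x)).
  rewrite -[contr _ _]/(h _) linear_sum sum_ffunE; apply: eq_bigr => j _.
  by rewrite linearZ ffunE /c valK mulrC.
have : g`_i = 0.
  suff -> : g = 0 by rewrite coef0.
  apply/eqP/negP => /negP/(avoid_root S)[t tS].
  by rewrite /root gE ct // ffunE eqxx.
by rewrite coef_poly ltn_ord /c valK.
Qed.

Lemma L_coefv_sum g n (k : nat) x : (size g <= n)%N ->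
  L (coefv (g * 'X^k)) x = \sum_(j < n) g`_j *: L (coefv 'X^(j + k)) x.
Proof.
move=> sg; pose h := HB.pack_for {linear 'rV[F]_m -> ext F m} ((@L F m)^~ x)
    (GRing.isLinear.Build F _ _ _ _ (L_linear_l x)).
rewrite (_ : coefv _ = \sum_(j < n) g`_j *: coefv 'X^(j + k)).
  by rewrite -[L _ _]/(h _) linear_sum; apply: eq_bigr => j _; rewrite linearZ.
have {1}-> : g = \sum_(j < n) g`_j *: 'X^j.
  rewrite -poly_def; apply/polyP => i; rewrite coef_poly.
  by case: ltnP => // ni; rewrite nth_default // (leq_trans sg).
apply/rowP => i; rewrite mxE mulr_suml coef_sum summxE; apply: eq_bigr => j _.
by rewrite -scalerAl -exprD coefZ !mxE.
Qed.

(** With q = (X - t_1)...(X - t_p), the combination of the p+1 hypotheses with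
    the coefficients of q reads sum_k (q X^k) /\ x_k = 0. Contracting it at
    t_0, t_1, ..., t_p leaves q(t_0) sum_k t_0^k x_k(t_1, ..., t_p), a
    polynomial in t_0 whose coefficients are thus all zero. *)
Lemma hankel_inj p (x : 'I_p.+1 -> ext F m) : (2 * p + 1 <= m)%N ->
  (forall k, homogeneous p (x k)) ->
  (forall j : 'I_p.+1, \sum_(k < p.+1) L (coefv 'X^(j + k)) (x k) = 0) ->
  forall k, x k = 0.
Proof.
move=> lm hx x0 k0; apply: (icontr_separates (S := [::]) (hx k0)) => ts _ sts _.
pose q := \prod_(t <- ts) ('X - t%:P).
have sq : size q = p.+1 by rewrite size_prod_XsubC sts.
have szqk (k : 'I_p.+1) : (size (q * 'X^k)%R <= m)%N.
  rewrite size_Mmonic ?monicXn ?monic_neq0 ?monic_prod_XsubC // size_polyXn sq.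
  rewrite addnS /= (leq_trans _ lm) // addn1 mul2n -addnn addSn ltnS leq_add2l.
  by rewrite -ltnS.
have q0 : \sum_(k < p.+1) L (coefv (q * 'X^k)) (x k) = 0.
  under eq_bigr => k _ do rewrite (@L_coefv_sum q p.+1) ?sq //.
  rewrite exchange_big big1 //= => j _.
  by rewrite -scaler_sumr x0 scaler0.
have key t0 : t0 \notin ts -> \sum_(k < p.+1) t0 ^+ k *: icontr ts (x k) = 0.
  move=> t0ts; have : icontr (t0 :: ts)
      (\sum_(k < p.+1) L (coefv (q * 'X^k)) (x k)) = 0.
    by rewrite q0 linear0.
  rewrite linear_sum /=.
  under eq_bigr => k _.
    rewrite contr_evalv // linearB linearZ /= icontr_roots //; last first.
      by apply/allP => t tts; rewrite rootM root_prod_XsubC tts.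
    (* The term left over by the antiderivation rule is a contraction of x_k
       at p+1 points, one more than its degree. *)
    rewrite -[icontr ts (contr _ _)]/(icontr (t0 :: ts) (x k)).
    rewrite (@icontr_homogeneous_eq0 p (t0 :: ts)) //= ?sts //.
    rewrite linear0 scaler0 subr0.
    rewrite hornerM hornerXn -scalerA; over.
  rewrite -scaler_sumr => /eqP; rewrite scaler_eq0 => /orP[|/eqP //].
  by rewrite -/(root q t0) root_prod_XsubC (negbTE t0ts).
apply/ffunP => A; rewrite [RHS]ffunE.
pose c (k : nat) : F := icontr ts (x (inord k)) A.
pose g := \poly_(k < p.+1) c k.
have : g`_k0 = 0.
  suff -> : g = 0 by rewrite coef0.
  apply/eqP/negP => /negP/(avoid_root ts)[t tS]; rewrite /root.
  have /ffunP/(_ A) := key t tS; rewrite sum_ffunE ffunE horner_poly => e.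
  case/eqP; rewrite -[RHS]e; apply: eq_bigr => k _.
  by rewrite ffunE /c inord_val mulrC.
by rewrite coef_poly ltn_ord /c inord_val.
Qed.

End Hankel.

Section BaseChange.
Variables (K : fieldType) (m : nat).

(** The powers of the indeterminate are infinitely many elements of K(X). *)
Lemma ratfrac_infinite (g : {poly {fraction {poly K}}}) :
  g != 0 -> exists t, ~~ root g t.
Proof.
move=> g0; pose rs := [seq tofrac ('X^n : {poly K}) | n <- iota 0 (size g)].
have uniq_rs : uniq rs.
  rewrite map_inj_uniq ?iota_uniq // => a b /eqP; rewrite tofrac_eq => /eqP e.
  by have := congr1 (fun q : {poly K} => size q) e; rewrite !size_polyXn => -[].
have [rs0|/allPn[t _ gt]] := boolP (all (root g) rs); last by exists t.
by have := max_poly_roots g0 rs0 uniq_rs; rewrite size_map size_iota ltnn.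
Qed.

Definition ext_map (F : fieldType) (f : K -> F) (x : ext K m) : ext F m :=
  [ffun A : {set 'I_m} => f (x A)].

Lemma ext_map_L (F : fieldType) (f : {rmorphism K -> F}) n (x : ext K m) :
  L (coefv m 'X^n) (ext_map f x) = ext_map f (L (coefv m 'X^n) x).
Proof.
apply/ffunP => A; rewrite !ffunE !LE rmorph_sum; apply: eq_bigr => i _ /=.
by rewrite !rmorphM rmorph_sign !mxE !coefXn rmorph_nat ffunE.
Qed.

(** Over a finite field there may be too few points to evaluate at, but the
    Hankel matrix has its coefficients in the prime field, so that the
    hypotheses carry over to K(X). *)
Lemma hankel_injective p (x : 'I_p.+1 -> ext K m) : (2 * p + 1 <= m)%N ->
  (forall k, homogeneous p (x k)) ->
  (forall j : 'I_p.+1, \sum_(k < p.+1) L (coefv m 'X^(j + k)) (x k) = 0) ->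
  forall k, x k = 0.
Proof.
move=> lm hx x0 k.
pose f : {rmorphism K -> {fraction {poly K}}} := @tofrac _ \o polyC.
have /ffunP fx0 : ext_map f (x k) = 0.
  apply: (hankel_inj ratfrac_infinite (x := fun k => ext_map f (x k)) lm).
    move=> l A nA.
    by rewrite ffunE hx // rmorph0.
  move=> j.
  under eq_bigr => l _ do rewrite ext_map_L.
  apply/ffunP => A; have /ffunP/(_ A) := x0 j.
  rewrite !sum_ffunE !ffunE => /(congr1 f); rewrite rmorph_sum rmorph0 => {2}<-.
  by apply: eq_bigr => l _; rewrite ffunE.
apply/ffunP => A; have := fx0 A; rewrite !ffunE -(rmorph0 f).
exact: fmorph_inj.
Qed.

End BaseChange.

(** * A tensor on which the determinant does not vanish *)

Section Witness.
Variables (K : fieldType) (m r s : nat).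
Variables (b : r.-tuple (ext K m)) (b' : s.-tuple (ext K m)).

(** The matrix phi(T) acts on column vectors: a vector is read as a family of
    elements of the source exterior power, one for each column of the slices of
    T, and the j-th component of the result collects the entries of row j. *)
Lemma mulmx_phi_tr n n' (T : tensor K m n n') (v : 'rV_(r * n')) i j :
  (v *m (phi b b' T)^T) 0 (mxtens_index (i, j)) =
  coord b' i (\sum_k L (\row_l T (l, j, k))
                (\sum_a v 0 (mxtens_index (a, k)) *: tnth b a)).
Proof.
have phiE a k :
    phi b b' T (mxtens_index (i, j)) (mxtens_index (a, k)) =
    Lmx b b' (\row_l T (l, j, k)) i a.
  rewrite /phi summxE [in RHS](row_sum_delta (\row_l T (l, j, k))).
  rewrite (linear_suml _ (Lmx_linear b b')) summxE; apply: eq_bigr => l _.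
  pose h := HB.pack_for {linear 'rV[K]_m -> 'M[K]_(s, r)} (Lmx b b')
    (GRing.isLinear.Build K _ _ _ _ (Lmx_linear b b')).
  rewrite -[Lmx b b']/(h : _ -> _) linearZ tensmxE !mxE mulrC //.
rewrite mxE (reindex (@mxtens_index r n')) /=; last first.
  exists (@mxtens_unindex r n') => k _.
    exact: mxtens_indexK.
  exact: mxtens_unindexK.
rewrite (eq_bigr (fun ak => v 0 (mxtens_index (ak.1, ak.2)) *
  Lmx b b' (\row_l T (l, j, ak.2)) i ak.1)) => [|[a k] _]; last first.
  by rewrite mxE phiE.
rewrite linear_sum -(pair_bigA _ (fun a k => v 0 (mxtens_index (a, k)) *
  Lmx b b' (\row_l T (l, j, k)) i a)) /=.
rewrite exchange_big; apply: eq_bigr => k _ /=.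
set w : 'rV[K]_m := \row_l _; rewrite (linear_sum (L w)) linear_sum.
apply: eq_bigr => a _.
by rewrite (linearZZ (L w)) linearZ mxE.
Qed.

(** Two diagonal blocks, because d = 2(p+1) while the Hankel matrix has size
    p+1. *)
Definition hankel_blocks p : tensor K m (p.+1 + p.+1) (p.+1 + p.+1) :=
  [ffun t => match split t.1.2, split t.2 with
             | inl j, inl k => (coefv m 'X^(j + k)) 0 t.1.1
             | inr j, inr k => (coefv m 'X^(j + k)) 0 t.1.1
             | _, _ => 0
             end].

End Witness.

Lemma det_phi_hankel_blocks (K : fieldType) (m p D : nat)
    (b b' : D.-tuple (ext K m)) : m = (2 * p + 1)%N ->
  basis_of (extpow K m p) b -> basis_of (extpow K m p.+1) b' ->
  \det (phi b b' (hankel_blocks K m p)) != 0.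
Proof.
move=> em hb hb'; rewrite -det_tr.
apply/negP => /det0P[v /negP v0 vT]; apply: v0.
pose x k : ext K m := \sum_a v 0 (mxtens_index (a, k)) *: tnth b a.
have hx k : homogeneous p (x k).
  apply/mem_extpow/memv_suml => a _; apply/memvZ/(basis_mem hb)/mem_tnth.
have eqs j : \sum_k L (\row_l hankel_blocks K m p (l, j, k)) (x k) = 0.
  rewrite (@coord_span _ _ _ b' (\sum_k _)) ?(span_basis hb').
    rewrite big1 // => i _.
    by rewrite -mulmx_phi_tr vT mxE scale0r.
  by apply: memv_suml => k _; apply/mem_extpow; exact: homogeneous_L.
have rowE (h : 'I_m -> K) (c : 'rV[K]_m) :
    (forall l, h l = c 0 l) -> \row_l h l = c.
  by move=> e; apply/rowP => l; rewrite mxE.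
(* Each of the two blocks is a Hankel matrix. *)
have xl k : x (lshift p.+1 k) = 0.
  apply: (hankel_injective (x := fun k => x (lshift p.+1 k))) _ _ k => // [|j].
    by rewrite em.
  have := eqs (lshift _ j); rewrite big_split_ord /= [X in _ + X]big1 ?addr0.
    move=> {2}<-; apply: eq_bigr => l _; congr L; apply/esym/rowE => i.
    by rewrite ffunE /= !(unsplitK (inl _)).
  move=> l _; rewrite (rowE _ 0); [exact: L0l | move=> i]; rewrite ffunE /=.
  by rewrite (unsplitK (inl _)) (unsplitK (inr _)) mxE.
have xr k : x (rshift p.+1 k) = 0.
  apply: (hankel_injective (x := fun k => x (rshift p.+1 k))) _ _ k => // [|j].
    by rewrite em.
  have := eqs (rshift _ j); rewrite big_split_ord /= [X in X + _]big1 ?add0r.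
    move=> {2}<-; apply: eq_bigr => l _; congr L; apply/esym/rowE => i.
    by rewrite ffunE /= !(unsplitK (inr _)).
  move=> l _; rewrite (rowE _ 0); [exact: L0l | move=> i]; rewrite ffunE /=.
  by rewrite (unsplitK (inl _)) (unsplitK (inr _)) mxE.
apply/eqP/rowP => c; rewrite [RHS]mxE; case: (mxtens_indexP c) => a k.
have : x k = 0 by case: (split_ordP k) => l ->.
have /freeP fb := basis_free hb.
move=> xk; apply: (fb (fun a => v 0 (mxtens_index (a, k)))) _ a.
by rewrite -[RHS]xk; apply: eq_bigr => c' _; rewrite (tnth_nth 0).
Qed.

Lemma psi_surjective (K : fieldType) (a a' n n' : nat)
    (pi : {linear 'rV[K]_a -> 'rV[K]_a'}) :
  (forall y, exists x, pi x = y) ->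
  forall T : tensor K a' n n', exists S : tensor K a n n', psi pi S = T.
Proof.
move=> pi_onto T.
have [g gP] := fin_all_exists (fun i : 'I_a' => pi_onto (delta_mx 0 i)).
exists [ffun t => \sum_i T (i, t.1.2, t.2) * g i 0 t.1.1].
apply/ffunP => -[[i j] k]; rewrite ffunE /=.
rewrite (_ : \row_l _ = \sum_i T (i, j, k) *: g i); last first.
  apply/rowP => l; rewrite summxE mxE ffunE.
  by apply: eq_bigr => ? _; rewrite mxE.
rewrite linear_sum summxE (bigD1 i) //= linearZ gP !mxE !eqxx mulr1.
rewrite big1 ?addr0 //.
by move=> l li; rewrite linearZ gP !mxE eq_sym (negbTE li) andbF mulr0.
Qed.

(** * The equation for border rank 2d - 3 *)

Theorem corollary6p3 (K : fieldType) (d m p D : nat)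
    (hd : (2 <= d)%N) (hd_even : ~~ odd d)
    (hm : m = (d - 1)%N) (hp : m = (2 * p + 1)%N) (hD : D = 'C(m, p))
    (b b' : D.-tuple (ext K m))
    (hb : basis_of (extpow K m p) b) (hb' : basis_of (extpow K m p.+1) b')
    (pi : {linear 'rV[K]_d -> 'rV[K]_m})
    (hpi : forall y : 'rV[K]_m, exists x : 'rV[K]_d, pi x = y) :
  let f : polyOn K ('I_d * 'I_d * 'I_d)%type :=
    pullback (psi pi) (detpoly (phi b b')) in
  f != 0 /\
  forall (T : tensor K d d d) (r : nat),
    border_rank T r -> (r <= 2 * d - 3)%N -> peval f T = 0.
Proof.
move=> f.
have ed : d = (p.+1 + p.+1)%N by lia.
split.
  apply/eqP => f0; subst d; clear hm.
  have [S psiS] := psi_surjective hpi (hankel_blocks K m p).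
  have /eqP[] := det_phi_hankel_blocks hp hb hb'.
  by rewrite -psiS -peval_pullback_det_phi -/f f0 /peval meval0.
move=> T r [T_closure _] le_r.
apply: T_closure => S [k [[[u [v [w ->]]] _] le_k]].
rewrite peval_pullback_det_phi.
rewrite (linear_suml _ (@psi_linear _ _ _ _ _ pi)).
rewrite (linear_suml _ (phi_linear b b')).
set M := \sum_i _.
have b_homogeneous j : homogeneous p (tnth b j).
  by apply/mem_extpow/(basis_mem hb)/mem_tnth.
have rkM : (\rank M <= k * 'C(2 * p, p))%N.
  have -> : (k * 'C(2 * p, p) = \sum_(i < k) 'C(2 * p, p))%N.
    by rewrite sum_nat_const card_ord.
  rewrite /M; elim/big_rec2: _ => [|i c B _ IH]; first by rewrite mxrank0.
  apply: leq_trans (mxrank_add _ _) _; apply: leq_add => //.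
  rewrite psi_pure (_ : 2 * p = m.-1)%N; last by rewrite hp addn1.
  exact: rank_phi_pure.
have ltM : (\rank M < D * d)%N.
  apply: leq_ltn_trans rkM _.
  rewrite hD hp ed addnn -mul2n [ltnRHS]mulnC koszul_dim.
  rewrite ltn_mul2r bin_gt0 leq_pmull //=.
  lia.
apply/eqP; apply: contraTT ltM.
rewrite -unitfE -unitmxE -row_full_unit => /eqP ->.
by rewrite ltnn.
Qed.
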